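(* Let $(X,d)$, $(Y,d')$ be complete metric spaces, let $E, F$ be nonzero Banach spaces over the same scalar field ($\mathbb{R}$ or $\mathbb{C}$), and let $\Sigma,\Sigma'$ be modulus sets. Suppose that the generalized Lipschitz spaces $\mathrm{Lip}_\Sigma(X,E)$ and $\mathrm{Lip}_{\Sigma'}(Y,F)$ are Lipschitz normal. If $T : \mathrm{Lip}_{\Sigma}(X,E) \to \mathrm{Lip}_{\Sigma'}(Y,F)$ is a linear biseparating map, then there exist a homeomorphism $h : X \to Y$ and, for each $y \in Y$, a vector space isomorphism (a linear bijection, not assumed continuous) $S_y : E \to F$ such that $$Tf(y) = S_y\bigl(f(h^{-1}(y))\bigr) \quad \text{for all } f\in \mathrm{Lip}_\Sigma(X,E) \text{ and all } y \in Y.$$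
   Context: A modulus function is a nondecreasing $\sigma:[0,\infty)\to[0,\infty]$ with $\sigma(0)=0$ that is continuous at $0$. A modulus set is a nonempty set $\Sigma$ of modulus functions such that: (MS1) for all $\sigma_1,\sigma_2\in\Sigma$ there exist $\sigma\in\Sigma$ and $K<\infty$ with $\sigma_1+\sigma_2\le K\sigma$; (MS2) for every sequence $(\sigma_n)$ in $\Sigma$ and every summable sequence $(a_n)$ of nonnegative reals there exist $\sigma\in\Sigma$ and $K<\infty$ with $\sum a_n(\sigma_n\wedge 1)\le K\sigma$. For $f:X\to E$ the modulus of continuity is $\omega_f(\varepsilon)=\sup\{\|f(x_1)-f(x_2)\|: d(x_1,x_2)\le\varepsilon\}\in[0,\infty]$, $\varepsilon\ge 0$. The generalized Lipschitz space $\mathrm{Lip}_\Sigma(X,E)$ is the vector space of all $f:X\to E$ such that $\omega_f\le K\sigma$ for some $\sigma\in\Sigma$ and $K<\infty$; when $E$ is the scalar field it is written $\mathrm{Lip}_\Sigma(X)$. $\mathrm{Lip}_{\Sigma'}(Y,F)$ is defined similarly using $d'$. $\mathrm{Lip}_\Sigma(X)$ is Lipschitz normal if for all subsets $U,V$ of $X$ with $d(U,V)>0$ there is $f\in \mathrm{Lip}_\Sigma(X)$ with $0\le f\le 1$, $f=0$ on $U$ and $f=1$ on $V$; $\mathrm{Lip}_\Sigma(X,E)$ is Lipschitz normal if $\mathrm{Lip}_\Sigma(X)$ is. For a vector-valued function $f$, $C(f)=\{x: f(x)\ne 0\}$. A linear map $T:\mathrm{Lip}_\Sigma(X,E)\to\mathrm{Lip}_{\Sigma'}(Y,F)$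 is biseparating if it is a bijection and for all $f,g$: $C(f)\cap C(g)=\emptyset$ if and only if $C(Tf)\cap C(Tg)=\emptyset$. *)

(* Defs.v *)
From HB Require Import structures.
From mathcomp Require Import all_boot all_order all_algebra.
From mathcomp Require Import all_classical all_reals all_analysis.
From mathcomp Require Import complex.

Set Implicit Arguments.
Unset Strict Implicit.
Unset Printing Implicit Defensive.

Import Order.TTheory GRing.Theory Num.Theory.
Import numFieldNormedType.Exports.

Local Open Scope classical_set_scope.
Local Open Scope ring_scope.

Inductive scalars := RealScalars | ComplexScalars.

Definition scalar_field (R : realType) (s : scalars) : numFieldType :=
  match s with
  | RealScalars => R
  | ComplexScalars => R[i]
  end.

Definition scalar_re (R : realType) (s : scalars) : scalar_field R s -> R :=
  match s return scalar_field R s -> R with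
  | RealScalars => id
  | ComplexScalars => @complex.Re R
  end.

(* The norm of a normed module over K takes its values in K, hence in R[i] for
   complex spaces; it lies on the nonnegative real axis, and rnorm reads it as
   an element of R. *)
Definition rnorm (R : realType) (s : scalars)
  (E : normedModType (scalar_field R s)) (x : E) : R := scalar_re `|x|.

Definition complete_metric (R : realType) (X : metricType R) : Prop :=
  forall u : nat -> X, cauchy (u @ \oo) -> exists x : X, u @ \oo --> x.

(* Functions [0, +oo[ -> [0, +oo] are encoded as functions R -> \bar R of which
   only the values on [0, +oo[ are ever constrained or used. *)
Definition modulus (R : realType) (sigma : R -> \bar R) : Prop :=
  [/\ forall t : R, 0 <= t -> (0 <= sigma t)%E,
      forall t u : R, 0 <= t -> t <= u -> (sigma t <= sigma u)%E,
      sigma 0 = 0%E &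
      sigma @ within [set t | 0 <= t] (nbhs (0 : R)) --> sigma 0].

Definition dominated (R : realType) (phi sigma : R -> \bar R) : Prop :=
  exists2 K : R, 0 <= K & forall t : R, 0 <= t -> (phi t <= K%:E * sigma t)%E.

Record modulus_set (R : realType) (Sigma : set (R -> \bar R)) : Prop := {
  modulus_set_neq0 : Sigma !=set0 ;
  modulus_set_modulus : forall sigma, Sigma sigma -> modulus sigma ;
  modulus_setD : forall sigma1 sigma2, Sigma sigma1 -> Sigma sigma2 ->
    exists2 sigma, Sigma sigma &
      dominated (fun t => (sigma1 t + sigma2 t)%E) sigma ;
  modulus_set_series : forall (sigma_ : nat -> R -> \bar R) (a : nat -> R),
    (forall n, Sigma (sigma_ n)) -> (forall n, 0 <= a n) -> cvgn (series a) ->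
    exists2 sigma, Sigma sigma &
      dominated
        (fun t => (\sum_(0 <= n <oo) ((a n)%:E * mine (sigma_ n t) 1))%E) sigma
}.

(* The supremum is taken in [0, +oo], hence is 0 when X is empty. *)
Definition modulus_of_continuity (R : realType) (s : scalars)
  (X : metricType R) (E : normedModType (scalar_field R s)) (f : X -> E)
  (e : R) : \bar R :=
  maxe 0%E (ereal_sup [set r | exists x1 x2 : X,
    mdist x1 x2 <= e /\ r = (rnorm (f x1 - f x2))%:E]).

Definition Lip (R : realType) (s : scalars) (Sigma : set (R -> \bar R))
  (X : metricType R) (E : normedModType (scalar_field R s)) : set (X -> E) :=
  [set f | exists2 sigma, Sigma sigma &
     dominated (modulus_of_continuity f) sigma].
Arguments Lip {R s} Sigma X E.

Definition set_dist (R : realType) (X : metricType R) (U V : set X) : \bar R :=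
  ereal_inf [set r | exists x y : X, [/\ U x, V y & r = (mdist x y)%:E]].

(* Over R[i] the order is that of the reals on numbers with equal imaginary
   parts, so 0 <= f x <= 1 also says that f x is real. *)
Definition Lipschitz_normal (R : realType) (s : scalars)
  (Sigma : set (R -> \bar R)) (X : metricType R) : Prop :=
  forall U V : set X, (0 < set_dist U V)%E ->
    exists f : X -> (scalar_field R s)^o,
      [/\ Lip Sigma X (scalar_field R s)^o f,
          forall x, 0 <= f x <= 1,
          forall x, U x -> f x = 0 &
          forall x, V x -> f x = 1].

Definition cozero (X : Type) (V : zmodType) (f : X -> V) : set X :=
  [set x | f x != 0].

Definition linear_on (K : numFieldType) (V W : lmodType K) (A : set V)
  (T : V -> W) : Prop :=
  forall (a : K) (f g : V), A f -> A g -> T (a *: f + g) = a *: T f + T g.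

(* T stands for a map A -> B: its values outside A are irrelevant. *)
Definition biseparating (X Y : Type) (V W : zmodType) (A : set (X -> V))
  (B : set (Y -> W)) (T : (X -> V) -> (Y -> W)) : Prop :=
  set_bij A B T /\
  forall f g, A f -> A g ->
    (cozero f `&` cozero g = set0 <-> cozero (T f) `&` cozero (T g) = set0).

Definition homeomorphism (X Y : topologicalType) (h : X -> Y) (k : Y -> X) :
  Prop := [/\ cancel h k, cancel k h, continuous h & continuous k].

(* Main.v *)
Require Import Defs.
From HB Require Import structures.
From mathcomp Require Import all_boot all_order all_algebra.
From mathcomp Require Import all_classical all_reals all_analysis.
From mathcomp Require Import complex lra.

Set Implicit Arguments.
Unset Strict Implicit.
Unset Printing Implicit Defensive.

Import Order.TTheory GRing.Theory Num.Theory.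
Import numFieldNormedType.Exports.
Local Open Scope classical_set_scope.
Local Open Scope ring_scope.

(* Disjointness tests inclusion of supports, so T f and T g agree on a set as
   soon as f and g agree on a corresponding set. The points of Y reached by T
   from the balls B(x, r) therefore form a filter base on Y. It is Cauchy: two
   sets U, V at positive distance cannot both meet every member, since cutting
   off phi = T(const e) to be phi near U and 0 near V would give a function
   whose preimage is both e and 0 at x. The cut-off is legitimate because phi
   is bounded on some member; otherwise |phi| takes values t_0 << t_1 << ...
   along points of the members, and composing phi with a radial Lipschitz map
   that is the identity near the spheres of radius t_k, k odd, and 0 near those
   with k even yields the same contradiction without any control on distances.
   The limits define h, whose inverse comes from T^-1. The radial maps, used
   along values of |f| decreasing quickly to 0, also show that f(x) = 0 implies
   T f(h x) = 0. *)

(** * Real numbers inside the scalar field, and the real-valued norm *)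

Section Scalars.
Context {R : realType} {s : scalars}.
Local Notation K := (scalar_field R s).

Definition rscal : R -> K :=
  match s return R -> scalar_field R s with
  | RealScalars => id
  | ComplexScalars => real_complex R
  end.

Lemma scalar_reK r : scalar_re (rscal r) = r.
Proof. by rewrite /rscal /scalar_re; case: s. Qed.

Lemma rscal0 : rscal 0 = 0.
Proof. by rewrite /rscal; case: s. Qed.

Lemma rscal1 : rscal 1 = 1.
Proof. by rewrite /rscal; case: s. Qed.

Lemma rscalD a b : rscal (a + b) = rscal a + rscal b.
Proof. by rewrite /rscal; case: s => //; rewrite rmorphD. Qed.

Lemma rscalM a b : rscal (a * b) = rscal a * rscal b.
Proof. by rewrite /rscal; case: s => //; rewrite rmorphM. Qed.

Lemma rscalB a b : rscal (a - b) = rscal a - rscal b.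
Proof. by rewrite /rscal; case: s => //; rewrite rmorphB. Qed.

Lemma ler_rscal a b : (rscal a <= rscal b) = (a <= b).
Proof. by rewrite /rscal; case: s => //; rewrite lecR. Qed.

Lemma normr_rscal a : `|rscal a| = rscal `|a|.
Proof.
by rewrite /rscal; case: s => //; rewrite normc_def /= expr0n addr0 sqrtr_sqr.
Qed.

Lemma scalar_re_ge0 (a : K) : 0 <= a -> a = rscal (scalar_re a).
Proof.
rewrite /rscal /scalar_re; case: s a => [//|] [x y].
by rewrite lecE => /andP[/eqP/= -> _].
Qed.

Lemma rscal_inj : injective rscal.
Proof. by move=> a b /(congr1 (@scalar_re R s)); rewrite !scalar_reK. Qed.

Section Norm.
Context {E : normedModType K}.
Implicit Types u v : E.

Lemma rnormE u : `|u| = rscal (rnorm u).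
Proof. exact: scalar_re_ge0. Qed.

Lemma rnorm_ge0 u : 0 <= rnorm u.
Proof. by rewrite -ler_rscal -rnormE rscal0. Qed.

Lemma rnorm_eq0 u : (rnorm u == 0) = (u == 0).
Proof. by rewrite -(inj_eq rscal_inj) -rnormE rscal0 normr_eq0. Qed.

Lemma rnorm0 : rnorm (0 : E) = 0.
Proof. by apply/eqP; rewrite rnorm_eq0. Qed.

Lemma rnorm_gt0 u : (0 < rnorm u) = (u != 0).
Proof. by rewrite lt_def rnorm_eq0 rnorm_ge0 andbT. Qed.

Lemma rnormD u v : rnorm (u + v) <= rnorm u + rnorm v.
Proof. by rewrite -ler_rscal rscalD -!rnormE ler_normD. Qed.

Lemma rnormN u : rnorm (- u) = rnorm u.
Proof. by apply: rscal_inj; rewrite -!rnormE normrN. Qed.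

Lemma rdistC u v : rnorm (u - v) = rnorm (v - u).
Proof. by rewrite -rnormN opprB. Qed.

Lemma rnormZ (a : K) u : rnorm (a *: u) = scalar_re `|a| * rnorm u.
Proof.
by apply: rscal_inj; rewrite rscalM -!rnormE -scalar_re_ge0// normrZ.
Qed.

Lemma rnormZr r u : rnorm (rscal r *: u) = `|r| * rnorm u.
Proof. by rewrite rnormZ normr_rscal scalar_reK. Qed.

Lemma rnorm_dist u v : `|rnorm u - rnorm v| <= rnorm (u - v).
Proof.
have := rnormD (u - v) v; have := rnormD (v - u) u; rewrite !subrK rdistC.
by move=> *; rewrite ler_norml; lra.
Qed.

Lemma rnorm_distD v u w : rnorm (u - w) <= rnorm (u - v) + rnorm (v - w).
Proof. by have := rnormD (u - v) (v - w); rewrite addrA subrK. Qed.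

End Norm.
End Scalars.

(** * Two-point functions bounded by a modulus *)

Section Controlled.
Context {R : realType} {X : metricType R} (Sigma : set (R -> \bar R)).
Hypothesis hS : modulus_set Sigma.
Implicit Types N : X -> X -> R.

(** Bounding each pair directly, without a supremum, treats increments of vector-valued functions
    and of real cut-offs alike. *)
Definition controlled N := exists2 sigma, Sigma sigma &
  exists2 K : R, 0 <= K & forall a b, ((N a b)%:E <= K%:E * sigma (mdist a b))%E.

Lemma controlledD C1 C2 N1 N2 N : 0 <= C1 -> 0 <= C2 ->
  controlled N1 -> controlled N2 ->
  (forall a b, N a b <= C1 * N1 a b + C2 * N2 a b) -> controlled N.
Proof.
move=> C10 C20 [s1 S1 [K1 K10 h1]] [s2 S2 [K2 K20 h2]] le_N.
have [s3 S3 [K K0 h3]] := modulus_setD hS S1 S2.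
exists s3 => //; pose M := C1 * K1 + C2 * K2.
have M0 : 0 <= M by rewrite addr_ge0// mulr_ge0.
exists (M * K); first by rewrite mulr_ge0.
move=> a b; have t0 := mdist_ge0 a b; move: (h1 a b) (h2 a b) (h3 _ t0).
have [s1_ge0 _ _ _] := modulus_set_modulus hS S1.
have [s2_ge0 _ _ _] := modulus_set_modulus hS S2.
move: (s1_ge0 _ t0) (s2_ge0 _ t0); set t := mdist a b.
move=> s10 s20 {}h1 {}h2 {}h3.
apply: le_trans (_ : M%:E * (s1 t + s2 t) <= _)%E; last first.
  by rewrite EFinM -muleA lee_wpmul2l ?lee_fin.
apply: le_trans (_ : C1%:E * (N1 a b)%:E + C2%:E * (N2 a b)%:E <= _)%E.
  by rewrite -!EFinM -EFinD lee_fin.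
rewrite ge0_muleDr//; apply: leeD.
- apply: le_trans (_ : C1%:E * (K1%:E * s1 t) <= _)%E.
    by rewrite lee_wpmul2l ?lee_fin.
  by rewrite muleA lee_wpmul2r// -EFinM lee_fin lerDl mulr_ge0.
- apply: le_trans (_ : C2%:E * (K2%:E * s2 t) <= _)%E.
    by rewrite lee_wpmul2l ?lee_fin.
  by rewrite muleA lee_wpmul2r// -EFinM lee_fin lerDr mulr_ge0.
Qed.

Lemma controlled_le C N1 N : 0 <= C -> controlled N1 ->
  (forall a b, N a b <= C * N1 a b) -> controlled N.
Proof.
move=> C0 c1 le_N; apply: (controlledD C0 (lexx 0) c1 c1) => a b.
by rewrite mul0r addr0.
Qed.

Lemma controlled0 : controlled (fun _ _ => 0).
Proof.
have [sg Ss] := modulus_set_neq0 hS.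
by exists sg => //; exists 0 => // a b; rewrite mul0e.
Qed.

Lemma controlled_continuous N e : controlled N -> 0 < e ->
  exists2 d, 0 < d & forall a b, mdist a b < d -> N a b < e.
Proof.
move=> [sg Ss [K K0 NK]] e0.
have [sg0 _ sgz sgc] := modulus_set_modulus hS Ss.
(* [K + 1] rather than [K] allows [K = 0] and makes the final inequality strict. *)
have K1 : 0 < K + 1 by rewrite ltr_wpDl.
have eK : (0 < (e / (K + 1))%:E)%E by rewrite lte_fin divr_gt0.
have : \forall t \near within [set t | 0 <= t] (nbhs (0 : R)),
    (sg t < (e / (K + 1))%:E)%E.
  rewrite sgz in sgc; apply: (sgc [set y | (y < (e / (K + 1))%:E)%E]).
  by apply: open_nbhs_nbhs; split => //; exact: open_ereal_lt_ereal.
rewrite near_withinE => /nbhs_ballP[d /= d0 dP].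
exists d => // a b ab.
have ab0 := mdist_ge0 a b.
have {}dP : (sg (mdist a b) < (e / (K + 1))%:E)%E.
  by apply: dP => //=; rewrite /ball /= sub0r normrN ger0_norm.
rewrite -lte_fin (le_lt_trans (NK a b))//.
apply: (@le_lt_trans _ _ (K%:E * (e / (K + 1))%:E)%E).
  by apply: lee_wpmul2l; rewrite ?lee_fin// ltW.
by rewrite -EFinM lte_fin mulrCA gtr_pMr// ltr_pdivrMr// mul1r ltrDl.
Qed.

End Controlled.

(** * Generalized Lipschitz spaces *)

Section LipSpace.
Context {R : realType} {s : scalars} {X : metricType R}.
Local Notation K := (scalar_field R s).
Context (Sigma : set (R -> \bar R)) (hS : modulus_set Sigma).

(** A pair competes in the supremum taken at its own distance; conversely, monotonicity of the
    modulus passes from that distance to any larger [t]. *)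
Lemma LipE (E : normedModType K) (f : X -> E) :
  Lip Sigma X E f <-> controlled Sigma (fun a b => rnorm (f a - f b)).
Proof.
split=> -[sg Ss [C C0 fC]]; exists sg => //; exists C => //.
  move=> a b; apply: le_trans (fC _ (mdist_ge0 a b)).
  rewrite /modulus_of_continuity le_max; apply/orP; right.
  by apply: ereal_sup_ubound; exists a, b.
move=> t t0; have [sg0 sgm _ _] := modulus_set_modulus hS Ss.
rewrite /modulus_of_continuity ge_max; apply/andP; split.
  by rewrite mule_ge0 ?lee_fin ?sg0.
apply: ge_ereal_sup => _ [a [b [abt ->]]].
apply: le_trans (fC a b) _; rewrite lee_wpmul2l ?lee_fin//.
by rewrite sgm ?mdist_ge0.
Qed.

Context {E : normedModType K}.
Implicit Types f g : X -> E.

Lemma Lip_cst (e : E) : Lip Sigma X E (cst e).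
Proof.
apply/LipE; apply: controlled_le (lexx 0) (controlled0 hS) _ => // a b.
by rewrite subrr rnorm0 mul0r.
Qed.

Lemma Lip_lin (a : K) f g :
  Lip Sigma X E f -> Lip Sigma X E g -> Lip Sigma X E (a *: f + g).
Proof.
move=> /LipE fL /LipE gL; apply/LipE.
apply: (@controlledD _ _ _ hS (rnorm (a : K^o)) 1 _ _ _ _ ler01 fL gL) => //.
  exact: rnorm_ge0.
move=> x y; rewrite !fctE mul1r opprD addrACA -scalerBr.
by rewrite (le_trans (rnormD _ _))// rnormZ.
Qed.

Lemma LipB f g : Lip Sigma X E f -> Lip Sigma X E g -> Lip Sigma X E (f - g).
Proof.
move=> fL gL; rewrite -[f - g]/(f + - g) addrC -scaleN1r; exact: Lip_lin.
Qed.

Lemma Lip_near f x e : Lip Sigma X E f -> 0 < e ->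
  exists2 d, 0 < d & forall z, mdist x z < d -> rnorm (f x - f z) < e.
Proof.
move=> /LipE fL e0; have [d d0 fd] := controlled_continuous hS fL e0.
by exists d => // z; exact: fd.
Qed.

(** The increment splits as [(H a - H b) f a + H b (f a - f b)]; the bound [M] on [f] controls the
    first term. *)
Lemma Lip_mul (H : X -> R) (M : R) f :
  controlled Sigma (fun a b => `|H a - H b|) -> Lip Sigma X E f ->
  (forall x, `|H x| <= 1) -> (forall x, rnorm (f x) <= M) ->
  Lip Sigma X E (fun x => rscal (H x) *: f x).
Proof.
move=> Hc /LipE fL H1 fM; apply/LipE.
(* A negative [M] leaves no point in [X], so the estimate is vacuous. *)
have [M0|M0] := ltP M 0.
  apply: (controlled_le hS ler01 fL) => a b.
  by have := le_lt_trans (fM a) M0; rewrite ltNge rnorm_ge0.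
apply: (controlledD hS M0 ler01 Hc fL) => a b.
apply: le_trans (rnorm_distD (rscal (H b) *: f a) _ _) _.
rewrite -scalerBl -scalerBr -rscalB !rnormZr [M * _]mulrC.
by rewrite lerD// ?ler_wpM2r ?ler_wpM2l ?rnorm_ge0.
Qed.

End LipSpace.

(** * Radial maps of a normed space *)

Section Radial.
Context {R : realType} {s : scalars}.
Local Notation K := (scalar_field R s).
Context {E : normedModType K}.

(* At [u = 0] the quotient is [rho 0 / 0 = 0], and so is the value. *)
Definition radial (rho : R -> R) (u : E) : E :=
  rscal (rho (rnorm u) / rnorm u) *: u.

Lemma radial_id rho u : rho (rnorm u) = rnorm u -> radial rho u = u.
Proof.
rewrite /radial => ->; have [->|u0] := eqVneq u 0; first by rewrite scaler0.
by rewrite divff ?rnorm_eq0// rscal1 scale1r.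
Qed.

Lemma radial_0 rho u : rho (rnorm u) = 0 -> radial rho u = 0.
Proof. by rewrite /radial => ->; rewrite mul0r rscal0 scale0r. Qed.

Lemma rnorm_radial rho u : (forall t, 0 <= t -> 0 <= rho t <= t) ->
  rnorm (radial rho u) = rho (rnorm u).
Proof.
move=> rhoP; rewrite /radial rnormZr.
have /andP[r0 rt] := rhoP _ (rnorm_ge0 u).
rewrite ger0_norm ?divr_ge0 ?rnorm_ge0//.
have [u0|u0] := eqVneq (rnorm u) 0; last by rewrite divfK.
by move: r0 rt; rewrite u0 mulr0 => r0 rt; apply/eqP; rewrite eq_le r0.
Qed.

(** With [p w = rho |w| / |w|], the increment is [(p u - p v) u + p v (u - v)]. The first term
    contributes [L + 1] and the second [1], since [0 <= p v <= 1]. *)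
Lemma radial_lipschitz rho L u v :
  (forall t, 0 <= t -> 0 <= rho t <= t) ->
  (forall t t', `|rho t - rho t'| <= L * `|t - t'|) ->
  rnorm (radial rho u - radial rho v) <= (L + 2) * rnorm (u - v).
Proof.
move=> rhoP rhoL.
wlog v0 : u v / v != 0 => [hw|].
  have [->|/hw//] := eqVneq v 0; have [->|u0] := eqVneq u 0.
    by rewrite !subrr rnorm0 mulr0.
  by rewrite [leLHS]rdistC [X in _ * X]rdistC hw.
have p0 : rnorm v > 0 by rewrite rnorm_gt0.
set p := fun w : E => rho (rnorm w) / rnorm w.
have L0 : 0 <= L.
  by have := le_trans (normr_ge0 _) (rhoL 0 1); rewrite sub0r normrN1 mulr1.
have pv1 : 0 <= p v <= 1.
  have /andP[r0 rt] := rhoP _ (ltW p0).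
  by rewrite divr_ge0 ?ler_pdivrMr ?mul1r ?(ltW p0).
apply: le_trans (rnorm_distD (rscal (p v) *: u) _ _) _.
rewrite -scalerBl -scalerBr -rscalB !rnormZr.
(* Multiplying by [|u|] before estimating removes the division by a possibly small norm. *)
have -> : `|rho (rnorm u) / rnorm u - p v| * rnorm u =
    `|rho (rnorm u) - p v * rnorm u|.
  rewrite -[LHS]ger0_norm ?mulr_ge0 ?rnorm_ge0// normrM normr_id -normrM mulrBl.
  have [u0|u0] := eqVneq (rnorm u) 0; last by rewrite divfK.
  have := rhoP _ (rnorm_ge0 u); rewrite u0 -eq_le => /eqP <-.
  by rewrite !mulr0.
have -> : rho (rnorm u) - p v * rnorm u =
   (rho (rnorm u) - rho (rnorm v)) + p v * (rnorm v - rnorm u).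
  by rewrite mulrBr [p v * rnorm v]divfK ?gt_eqF// addrA subrK.
have := ler_normD (rho (rnorm u) - rho (rnorm v)) (p v * (rnorm v - rnorm u)).
have := rhoL (rnorm u) (rnorm v); rewrite normrM distrC [`|rnorm u - _|]distrC.
have [pv0 _] := andP pv1; rewrite (ger0_norm pv0).
have := rnorm_dist v u; rewrite rdistC.
move: pv1 (rnorm_ge0 (u - v)) (normr_ge0 (rnorm v - rnorm u)) => /andP[_].
nra.
Qed.

Lemma Lip_radial (X : metricType R) Sigma rho L (f : X -> E) :
  modulus_set Sigma ->
  (forall t, 0 <= t -> 0 <= rho t <= t) ->
  (forall t t', `|rho t - rho t'| <= L * `|t - t'|) ->
  Lip Sigma X E f -> Lip Sigma X E (radial rho \o f).
Proof.
move=> hS rhoP rhoL /(LipE hS) fL; apply/(LipE hS).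
apply: (@controlled_le _ _ _ hS (L + 2) _ _ _ fL).
  have := le_trans (normr_ge0 _) (rhoL 0 1); rewrite sub0r normrN1 mulr1; lra.
by move=> a b; exact: radial_lipschitz.
Qed.

End Radial.

(** * One-variable cut-offs and sparse sequences *)

Section Truncation.
Context {R : realType}.

(** The function [min(t, 4 d(t, A))] works: the distance to [A] is 1-Lipschitz, and the third
    hypothesis says that [b <= 4 d(b, A)] on [B]. *)
Lemma truncation (A B : set R) : A !=set0 ->
  (forall a, A a -> 0 <= a) ->
  (forall a b, A a -> B b -> b <= 4 * `|b - a|) ->
  exists rho : R -> R,
    [/\ forall t, 0 <= t -> 0 <= rho t <= t,
        forall t t', `|rho t - rho t'| <= 4 * `|t - t'|,
        forall a, A a -> rho a = 0 &
        forall b, B b -> rho b = b].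
Proof.
move=> [a0 Aa0] A0 AB; pose D t := [set `|t - a| | a in A].
pose d t := inf (D t).
have D0 t : D t !=set0 by exists `|t - a0|, a0.
have Dlb t : has_lbound (D t) by exists 0 => _ [a _ <-].
have d_le t a : A a -> d t <= `|t - a| by move=> Aa; apply: ge_inf => //; exists a.
have le_d t c : (forall a, A a -> c <= `|t - a|) -> c <= d t.
  by move=> h; apply: lb_le_inf => // _ [a Aa <-]; exact: h.
have d0 t : 0 <= d t by apply: le_d.
have dL t t' : d t <= d t' + `|t - t'|.
  rewrite -lerBlDr; apply: le_d => a Aa; rewrite lerBlDr.
  rewrite (le_trans (d_le _ _ Aa))// [leRHS]addrC.
  by rewrite (le_trans _ (ler_normD _ _))// addrA subrK.
exists (fun t => Num.min t (4 * d t)); split => [t t0|t t'|a Aa|b Bb].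
- by rewrite ge_min lexx le_min t0 mulr_ge0.
- have := dL t t'; have := dL t' t; rewrite distrC.
  have := ler_norm (t - t'); have := ler_norm (t' - t); rewrite [`|t' - t|]distrC.
  by rewrite ler_norml; case: (leP t (4 * d t)); case: (leP t' (4 * d t')); lra.
- have -> : d a = 0.
    by apply/eqP; rewrite eq_le d0 andbT; have := d_le a a Aa; rewrite subrr normr0.
  by rewrite mulr0 min_r ?A0.
- rewrite min_l//; suff : b / 4 <= d b by lra.
  by apply: le_d => a Aa; have := AB _ _ Aa Bb; lra.
Qed.

End Truncation.

Lemma sparse_choice (T : eqType) (P : nat -> set T) (r : T -> T -> Prop) :
  (forall n (l : seq T), exists2 y, P n y & forall z, z \in l -> r z y) ->
  exists2 y : nat -> T, forall n, P n (y n) & forall i j, (i < j)%N -> r (y i) (y j).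
Proof.
move=> h; have /choice[F FP] : forall p : nat * seq T, exists y,
    P p.1 y /\ forall z, z \in p.2 -> r z y.
  by move=> [n l]; have [y ? ?] := h n l; exists y.
(* [L n] lists the terms of index below [n], so each new term is chosen against all earlier ones. *)
pose L := fix L n := if n is m.+1 then F (m, L m) :: L m else [::].
have LP i j : (i < j)%N -> F (i, L i) \in L j.
  elim: j => // j IH; rewrite ltnS leq_eqVlt => /orP[/eqP ->|/IH ij] /=.
    by rewrite mem_head.
  by rewrite inE ij orbT.
exists (fun n => F (n, L n)) => [n|i j ij]; first exact: (FP (n, L n)).1.
by apply: (FP (j, L j)).2; exact: LP.
Qed.

Lemma seq_le_ub (R : realType) (T : eqType) (F : T -> R) (l : seq T) :
  exists M, forall z, z \in l -> F z <= M.
Proof.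
elim: l => [|a l [M IH]]; first by exists 0.
exists (Num.max (F a) M) => z; rewrite inE le_max => /orP[/eqP ->|/IH ->].
  by rewrite lexx.
by rewrite orbT.
Qed.

(** Lets the odd and the even terms of one sequence both enter every ball or trace of a shrinking
    family. *)
Lemma exists_invS_lt (R : realType) (r : R) (b : bool) : 0 < r ->
  exists2 k, odd k = b & k.+1%:R^-1 < r.
Proof.
move=> /ltr_add_invr[n]; rewrite add0r => nr.
exists (b + n.*2)%N; first by rewrite oddD odd_double addbF oddb.
apply: le_lt_trans nr; rewrite lef_pV2 ?posrE ?ltr0n// ler_nat ltnS.
by rewrite -addnn addnCA leq_addr.
Qed.

(** * Cut-offs from sparse values and from Lipschitz normality *)

Section Alternation.
Context {R : realType} {s : scalars} {X : metricType R}.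
Context {E : normedModType (scalar_field R s)}.
Context (Sigma : set (R -> \bar R)) (hS : modulus_set Sigma).

(* The values of [|f|] along [x] are so sparse that a Lipschitz function of
   [|f|] can switch [f] on and off along [x] whatever the distances between
   the points are. *)
Lemma Lip_alternate (f : X -> E) (x : nat -> X) : Lip Sigma X E f ->
  (forall n, f (x n) != 0) ->
  (forall i j, i != j -> 4 * rnorm (f (x i)) <= rnorm (f (x j)) \/
     4 * rnorm (f (x j)) <= rnorm (f (x i))) ->
  exists2 g, Lip Sigma X E g & forall k, exists2 r, 0 < r &
    forall z, mdist (x k) z < r -> g z = if odd k then f z else 0.
Proof.
move=> fL fx sparse; pose t k := rnorm (f (x k)).
have t0 k : 0 < t k by rewrite rnorm_gt0.
(* Radius [t k / 4] leaves room for the variation of [|f|] near [x k], while the ratio 4 between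
   values still keeps intervals of opposite parity as far apart as [truncation] asks. *)
pose I b := [set c | exists2 k, odd k = b & `|c - t k| < t k / 4].
have [|||rho [rho_le rho_lip rho0 rho1]] := @truncation R (I false) (I true).
- by exists (t 0%N), 0%N => //; rewrite subrr normr0 divr_gt0.
- by move=> c [k _]; have := t0 k; rewrite ltr_norml => ? /andP[]; lra.
- move=> a b [i io ai] [j jo bj].
  have ij : i != j by apply: contraFneq io => ->.
  move: ai bj (t0 i) (t0 j); rewrite !ltr_norml => /andP[? ?] /andP[? ?] ? ?.
  have := ler_norm (b - a); have := ler_norm (a - b); rewrite distrC.
  by case: (sparse _ _ ij); rewrite -!/(t _) => *; lra.
exists (radial rho \o f); first exact: Lip_radial fL.
move=> k; have [|r r0 rP] := @Lip_near _ _ _ _ hS _ f (x k) (t k / 4) fL.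
  by rewrite divr_gt0.
exists r => // z /rP zx.
have Iz : I (odd k) (rnorm (f z)).
  by exists k => //; rewrite distrC (le_lt_trans (rnorm_dist _ _)).
rewrite /=; move: Iz; case: (odd k) => Iz; first by rewrite radial_id ?rho1.
by rewrite radial_0 ?rho0.
Qed.

(** The normality function takes values between 0 and 1, hence real ones, so passing to its real
    part keeps all increments. *)
Lemma Lip_normal_real (U V : set X) (r : R) : Lipschitz_normal s Sigma X ->
  0 < r -> (forall x y, U x -> V y -> r <= mdist x y) ->
  exists H : X -> R, [/\ controlled Sigma (fun a b => `|H a - H b|),
    forall x, 0 <= H x <= 1, forall x, U x -> H x = 0 &
    forall x, V x -> H x = 1].
Proof.
move=> hn r0 UV; have [|f [fL f01 f0 f1]] := hn U V.
  apply: (@lt_le_trans _ _ r%:E); first by rewrite lte_fin.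
  by apply: le_ereal_inf_tmp => _ [x [y [Ux Vy ->]]]; rewrite lee_fin UV.
pose H x := scalar_re (f x).
have fE x : f x = rscal (H x).
  by have /andP[fx0 _] := f01 x; exact: scalar_re_ge0.
exists H; split.
- have {}fL := (LipE hS f).1 fL; apply: (controlled_le hS ler01 fL) => a b.
  have := @rnormE _ _ (scalar_field R s)^o (f a - f b).
  rewrite {1}[f a]fE {1}[f b]fE -rscalB [LHS]normr_rscal => /rscal_inj ->.
  by rewrite mul1r.
- move=> x; have := f01 x; rewrite fE.
  rewrite -[0 in X in X -> _](@rscal0 R s) -[1 in X in X -> _](@rscal1 R s).
  by rewrite !ler_rscal.
- by move=> x /f0; rewrite fE -(@rscal0 R s) => /rscal_inj.
- by move=> x /f1; rewrite fE -(@rscal1 R s) => /rscal_inj.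
Qed.

(** A scalar cut-off times a nonzero constant vector. *)
Lemma Lip_bump (x : X) (r : R) : Lipschitz_normal s Sigma X ->
  (exists e : E, e != 0) -> 0 < r ->
  exists u, [/\ Lip Sigma X E u, u x != 0 &
    forall z, r <= mdist x z -> u z = 0].
Proof.
move=> hn [e e0] r0.
have [|H [Hc H01 H0 H1]] :=
  @Lip_normal_real [set z | r <= mdist x z] [set x] r hn r0.
  by move=> a _ /= ax ->; rewrite metric_sym.
exists (fun z => rscal (H z) *: e); split.
- apply: (@Lip_mul _ _ _ _ hS _ H (rnorm e) (cst e)) => //; first exact: Lip_cst.
  by move=> z; have /andP[? ?] := H01 z; rewrite ger0_norm.
- by rewrite H1// rscal1 scale1r.
- by move=> z xz; rewrite H0// rscal0 scale0r.
Qed.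

Lemma Lip_eq0 (f : X -> E) x : Lip Sigma X E f ->
  (forall d, 0 < d -> exists2 z, mdist x z < d & f z = 0) -> f x = 0.
Proof.
move=> fL fz; apply/eqP/contraT; rewrite -rnorm_gt0 => fx0.
have [d d0 dP] := Lip_near hS x fL fx0.
by have [z /dP] := fz _ d0; move=> /[swap] ->; rewrite subr0 ltxx.
Qed.

Lemma Lip_neq0_near (f : X -> E) x : Lip Sigma X E f -> f x != 0 ->
  exists2 d, 0 < d & forall z, mdist x z < d -> f z != 0.
Proof.
rewrite -rnorm_gt0 => fL fx0; have [d d0 dP] := Lip_near hS x fL fx0.
by exists d => // z /dP; apply: contraTneq => ->; rewrite subr0 ltxx.
Qed.

End Alternation.

(** * Biseparating maps with an explicit inverse, and their traces *)

Record normal_Lip (R : realType) (s : scalars) (Sigma : set (R -> \bar R))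
    (X : metricType R) (E : normedModType (scalar_field R s)) : Prop := {
  normal_Lip_modulus : modulus_set Sigma ;
  normal_Lip_normal : Lipschitz_normal s Sigma X ;
  normal_Lip_neq0 : exists e : E, e != 0
}.

Record inv_biseparating (R : realType) (s : scalars)
    (Sigma Sigma' : set (R -> \bar R)) (X Y : metricType R)
    (E F : normedModType (scalar_field R s))
    (T : (X -> E) -> (Y -> F)) (S : (Y -> F) -> (X -> E)) : Prop := {
  bisep_Lip : forall f, Lip Sigma X E f -> Lip Sigma' Y F (T f) ;
  bisep_LipV : forall g, Lip Sigma' Y F g -> Lip Sigma X E (S g) ;
  bisepK : forall f, Lip Sigma X E f -> S (T f) = f ;
  bisepKV : forall g, Lip Sigma' Y F g -> T (S g) = g ;
  bisep_lin : linear_on (Lip Sigma X E) T ;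
  bisep_disj : forall f g, Lip Sigma X E f -> Lip Sigma X E g ->
    (cozero f `&` cozero g = set0 <-> cozero (T f) `&` cozero (T g) = set0)
}.

(** Every result on [T] thereby applies to [S] too. Linearity of [S] follows by writing its
    arguments as images under [T]. *)
Lemma inv_biseparating_sym (R : realType) (s : scalars)
    (Sigma Sigma' : set (R -> \bar R)) (X Y : metricType R)
    (E F : normedModType (scalar_field R s))
    (T : (X -> E) -> (Y -> F)) (S : (Y -> F) -> (X -> E)) :
  modulus_set Sigma -> inv_biseparating Sigma Sigma' T S ->
  inv_biseparating Sigma' Sigma S T.
Proof.
move=> hS [TL SL TK SK Tlin Tdisj]; split => //.
  move=> a f g fL gL; rewrite -[in LHS](SK _ fL) -[in LHS](SK _ gL).
  by rewrite -Tlin ?TK//; by [apply: SL|apply: Lip_lin => //; apply: SL].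
by move=> f g fL gL; rewrite Tdisj ?SK//; exact: SL.
Qed.

Lemma cozero_disjoint (X : Type) (V W : zmodType) (f : X -> V) (g : X -> W) :
  cozero f `&` cozero g = set0 <-> forall x, f x != 0 -> g x = 0.
Proof.
split=> [fg x fx|fg].
  apply/eqP/contraT => gx; have : (cozero f `&` cozero g) x by [].
  by rewrite fg.
by apply/seteqP; split => // x [/fg gx]; rewrite /cozero/= gx eqxx.
Qed.

(* The points of [Y] reached by [T] from the ball of radius [r] around [x];
   they shrink to [h x] when [r] tends to [0]. *)
Definition trace (R : realType) (s : scalars) (X Y : metricType R)
    (E F : normedModType (scalar_field R s)) (Sigma : set (R -> \bar R))
    (T : (X -> E) -> (Y -> F)) (x : X) (r : R) : set Y :=
  [set y | exists u, [/\ Lip Sigma X E u,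
     forall z, r <= mdist x z -> u z = 0 & T u y != 0]].

(** This is convergence to [h x] of the filter base formed by the traces at [x]. *)
Definition trace_limit (R : realType) (s : scalars) (X Y : metricType R)
    (E F : normedModType (scalar_field R s)) (Sigma : set (R -> \bar R))
    (T : (X -> E) -> (Y -> F)) (h : X -> Y) :=
  forall x eps, 0 < eps -> exists2 r, 0 < r &
    forall y, trace Sigma T x r y -> mdist (h x) y < eps.

(** * Convergence of the traces *)

Section Biseparating.
Context {R : realType} {s : scalars} {X Y : metricType R}.
Context {E F : normedModType (scalar_field R s)}.
Context {Sigma Sigma' : set (R -> \bar R)}.
Context {T : (X -> E) -> (Y -> F)} {S : (Y -> F) -> (X -> E)}.
Hypothesis nX : normal_Lip Sigma X E.
Hypothesis nY : normal_Lip Sigma' Y F.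
Hypothesis TS : inv_biseparating Sigma Sigma' T S.

Let hS := normal_Lip_modulus nX.
Let hS' := normal_Lip_modulus nY.
Local Notation LX := (Lip Sigma X E).
Local Notation LY := (Lip Sigma' Y F).

Lemma bisep0 : T 0 = 0.
Proof.
have L0 : LX 0 by exact: Lip_cst.
have := bisep_lin TS 1 L0 L0; rewrite !scale1r addr0 => /eqP.
by rewrite -[X in X == _]addr0 (inj_eq (addrI _)) eq_sym => /eqP.
Qed.

Lemma bisepB f g : LX f -> LX g -> T (f - g) = T f - T g.
Proof.
move=> fL gL; rewrite addrC -[- g]scaleN1r (bisep_lin TS)// scaleN1r.
by rewrite addrC.
Qed.

Lemma bisep_disjoint f g : LX f -> LX g ->
  (forall x, f x != 0 -> g x = 0) <-> (forall y, T f y != 0 -> T g y = 0).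
Proof. by move=> fL gL; have := bisep_disj TS fL gL; rewrite !cozero_disjoint. Qed.

Lemma bisep_neq0 f x : LX f -> f x != 0 -> exists y, T f y != 0.
Proof.
move=> fL; apply: contra_neqP => /forallNP Tf0.
have : T f = T 0.
  by rewrite bisep0; apply/funext => y; apply/eqP/contraT => /Tf0.
have L0 : LX 0 by exact: Lip_cst.
by move=> /(congr1 S); rewrite !(bisepK TS)// => ->.
Qed.

(** A bump [v] at [x] inside the ball is disjoint from [f], so [T v] is disjoint from [T f] and
    hence from [T u]. Then [v] is disjoint from [u], while [v x] is nonzero. *)
Lemma bisep_support f u x r : LX f -> LX u ->
  (forall y, T f y = 0 -> T u y = 0) -> 0 < r ->
  (forall z, mdist x z < r -> f z = 0) -> u x = 0.
Proof.
move=> fL uL fu r0 f0.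
have [v [vL vx v0]] :=
  Lip_bump hS x (normal_Lip_normal nX) (normal_Lip_neq0 nX) r0.
apply: (bisep_disjoint vL uL).2 vx => y Tvy; apply: fu.
apply: (bisep_disjoint vL fL).1 Tvy => z; apply: contra_neqP => /eqP fz.
by apply: v0; rewrite leNgt; apply: contra_neqN fz; exact: f0.
Qed.

Local Notation trace := (trace Sigma T).

Lemma trace_le x x' r r' : mdist x' x + r <= r' -> trace x r `<=` trace x' r'.
Proof.
move=> rr' y [u [uL u0 Tuy]]; exists u; split=> // z zr; apply: u0.
by have := metric_triangle x' x z; lra.
Qed.

Lemma traceS x r r' : r <= r' -> trace x r `<=` trace x r'.
Proof. by move=> rr'; apply: trace_le; rewrite mdistxx add0r. Qed.

Lemma trace_neq0 x r : 0 < r -> trace x r !=set0.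
Proof.
move=> r0.
have [u [uL ux u0]] :=
  Lip_bump hS x (normal_Lip_normal nX) (normal_Lip_neq0 nX) r0.
by have [y Tuy] := bisep_neq0 uL ux; exists y, u.
Qed.

Lemma trace_open x r y : trace x r y ->
  exists2 d, 0 < d & forall z, mdist y z < d -> trace x r z.
Proof.
move=> [u [uL u0 Tuy]].
have [d d0 dP] := Lip_neq0_near hS' (bisep_Lip TS uL) Tuy.
by exists d => // z zd; exists u; split=> //; exact: dP.
Qed.

(** If [f1 - f2] is nonzero on a ball around [x], take [w] supported near a trace point [y], where
    [T f1 = T f2] and [T u] does not vanish. Then [S w] is disjoint from [f1 - f2], so it lives off
    the ball; but its support is governed by [u], which lives inside. *)
Lemma bisep_eq_at f1 f2 x : LX f1 -> LX f2 ->
  (forall r, 0 < r -> exists y, trace x r y /\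
     exists2 d, 0 < d & forall z, mdist y z < d -> T f1 z = T f2 z) ->
  f1 x = f2 x.
Proof.
move=> L1 L2 Tf12; apply/eqP; rewrite -subr_eq0.
have L12 : LX (f1 - f2) by exact: LipB.
apply/contraT => /(Lip_neq0_near hS L12)[r r0 rP].
(* Half the radius makes [u] vanish on a whole ball of radius [r / 2] around any point at distance
   at least [r] from [x]. *)
have [|y [[u [uL u0 Tuy]] [d d0 dP]]] := Tf12 (r / 2); first by rewrite divr_gt0.
have [d' d'0 d'P] := Lip_neq0_near hS' (bisep_Lip TS uL) Tuy.
have m0 : 0 < Num.min d d' by rewrite lt_min d0.
have [w [wL wy w0]] :=
  Lip_bump hS' y (normal_Lip_normal nY) (normal_Lip_neq0 nY) m0.
have wm z : w z != 0 -> mdist y z < Num.min d d'.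
  by rewrite ltNge; apply: contraNN => /w0 ->.
have SwL := bisep_LipV TS wL.
have [z Swz] : exists z, S w z != 0.
  apply: contraPP wy => /forallNP Sw0.
  have : S w = 0 by apply/funext => z; apply/eqP/contraT => /Sw0.
  by move=> /(congr1 T); rewrite (bisepKV TS)// bisep0 => ->; rewrite eqxx.
have f12z : (f1 - f2) z = 0.
  apply: (bisep_disjoint SwL L12).2 Swz => y'; rewrite (bisepKV TS)// => /wm.
  by rewrite lt_min bisepB// => /andP[/dP e _]; rewrite fctE e subrr.
have xz : r <= mdist x z.
  by rewrite leNgt; apply/negP => /rP; rewrite f12z eqxx.
suff : S w z = 0 by move=> Swz0; rewrite Swz0 eqxx in Swz.
apply: (@bisep_support u _ z (r / 2)) => //; last 2 first.
- by rewrite divr_gt0.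
- move=> z' zz'; apply: u0; have := metric_triangle x z' z.
  by rewrite [mdist z' z]metric_sym; lra.
move=> y'; apply: contra_eq; rewrite (bisepKV TS)// => /wm.
by rewrite lt_min => /andP[_ /d'P].
Qed.

Let Lc (e : E) : LX (cst e) := Lip_cst hS e.

(** Otherwise trace points with norms growing by factors of at least 4 give, through
    [Lip_alternate], a [g] for which [S g x] is both [e] and 0. *)
Lemma bisep_cst_bounded (x : X) (e : E) : e != 0 -> exists2 r, 0 < r &
  exists M, forall y, trace x r y -> rnorm (T (cst e) y) <= M.
Proof.
move=> e0; apply: contrapT => hN; pose phi := T (cst e).
have phiL : LY phi by apply: (bisep_Lip TS).
have unb r M : 0 < r -> exists2 y, trace x r y & M < rnorm (phi y).
  move=> r0; apply: contrapT => h; apply: hN; exists r => //; exists M => y Ty.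
  by rewrite leNgt; apply/negP => My; apply: h; exists y.
have [n l|y yP ysp] := @sparse_choice Y
    (fun n => [set y | trace x n.+1%:R^-1 y /\ 0 < rnorm (phi y)])
    (fun z y => 4 * rnorm (phi z) <= rnorm (phi y)).
  have [M MP] := seq_le_ub (fun z => rnorm (phi z)) l.
  (* The maximum with 0 keeps [phi] nonzero at the new point even when the list is empty and [M] has
     no known sign. *)
  have [|y Ty My] := unb n.+1%:R^-1 (Num.max 0 (4 * M)).
    by rewrite invr_gt0 ltr0n.
  move: My; rewrite gt_max => /andP[y0 yM].
  by exists y => // z /MP zM; lra.
have [||g gL gP] := @Lip_alternate _ _ _ _ _ hS' phi y phiL.
- by move=> n; rewrite -rnorm_gt0; have [] := yP n.
- by move=> i j; rewrite neq_ltn => /orP[/ysp|/ysp]; [left|right].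
have SgL := bisep_LipV TS gL.
have key b c : LX (cst c) -> (forall z, T (cst c) z = if b then phi z else 0) ->
    S g x = c.
  move=> cL cE; rewrite -[RHS]/(cst c x); apply: bisep_eq_at => // r r0.
  have [k kb kr] := exists_invS_lt b r0; exists (y k); split.
    by have [/traceS + _] := yP k; apply; exact: ltW.
  have [d d0 dP] := gP k; exists d => // z /dP.
  by rewrite (bisepKV TS)// kb cE.
have /esym Sge := key true e (Lc _) (fun _ => erefl).
suff Sg0 : S g x = 0 by rewrite Sge Sg0 eqxx in e0.
by apply: (key false) => // z; rewrite -[cst 0]/(0 : X -> E) bisep0.
Qed.

(** A function equal to [phi] near some points of [U] in every trace, and to 0 near [V], would have
    a preimage with both values [e] and 0 at [x]. *)
Lemma trace_proximity (x : X) (U V : set Y) (r : R) : 0 < r ->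
  (forall u v, U u -> V v -> 3 * r <= mdist u v) ->
  (forall t, 0 < t -> trace x t `&` U !=set0) ->
  (forall t, 0 < t -> trace x t `&` V !=set0) -> False.
Proof.
move=> r0 UV tU tV; have [e e0] := normal_Lip_neq0 nX.
have [r1 r10 [M MP]] := bisep_cst_bounded x e0; pose phi := T (cst e).
have phiL : LY phi by apply: (bisep_Lip TS).
have M0 : 0 <= M.
  have [y /MP] := trace_neq0 x r10; apply: le_trans; exact: rnorm_ge0.
(* The cut-off must be constant on balls around the points of [U] and of [V], hence these
   neighbourhoods; the gap [3 * r] keeps them at distance at least [r]. *)
pose nb (A : set Y) := [set z | exists2 a, A a & mdist a z < r].
have [||H [Hc H01 H0 H1]] :=
  @Lip_normal_real _ s _ _ hS' (nb V) (nb U) r (normal_Lip_normal nY).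
- by [].
- move=> a b [v Vv va] [u Uu ub]; have := UV _ _ Uu Vv.
  have := metric_triangle u b v; have := metric_triangle b a v.
  by rewrite [mdist a v]metric_sym [mdist b a]metric_sym; lra.
(* Truncating the norm at [M] makes the factor bounded everywhere, as [Lip_mul] requires, and leaves
   [phi] unchanged on [trace x r1]. *)
pose rho t := Num.min t M.
have rhoP t : 0 <= t -> 0 <= rho t <= t.
  by move=> t0; rewrite ge_min lexx le_min t0 M0.
have rhoL t t' : `|rho t - rho t'| <= 1 * `|t - t'|.
  rewrite mul1r /rho.
  have := ler_norm (t - t'); have := ler_norm (t' - t); rewrite [`|t' - t|]distrC.
  have := normr_ge0 (t - t').
  by rewrite ler_norml; case: (leP t M); case: (leP t' M); lra.
pose g := fun z => rscal (H z) *: radial rho (phi z).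
have gL : LY g.
  apply: (@Lip_mul _ _ _ _ hS' _ H M (radial rho \o phi)) => //.
  - exact: Lip_radial phiL.
  - by move=> z; have /andP[? ?] := H01 z; rewrite ger0_norm.
  - by move=> z; rewrite rnorm_radial// /rho ge_min lexx orbT.
have SgL := bisep_LipV TS gL.
suff : e = 0 by move=> e0'; rewrite e0' eqxx in e0.
transitivity (S g x).
  rewrite -[LHS]/(cst e x); apply: bisep_eq_at => // t t0.
  have [|y [ty Uy]] := tU (Num.min t r1); first by rewrite lt_min t0.
  exists y; split; first by apply: traceS ty; rewrite ge_min lexx.
  have [|d d0 dP] := @trace_open x r1 y.
    by apply: traceS ty; rewrite ge_min lexx orbT.
  exists (Num.min d r); first by rewrite lt_min d0.
  move=> z; rewrite lt_min => /andP[/dP/MP zM zr]; rewrite (bisepKV TS)// /g.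
  rewrite H1; last by exists y.
  by rewrite rscal1 scale1r radial_id// /rho min_l.
rewrite -[RHS]/((0 : X -> E) x); apply: bisep_eq_at => //; first exact: Lip_cst.
move=> t t0; have [y [ty Vy]] := tV t t0; exists y; split=> //.
exists r => // z zr; rewrite (bisepKV TS)// /g H0; last by exists y.
by rewrite rscal0 scale0r bisep0.
Qed.

(** Either there is an [eta]-separated sequence in the shrinking traces, whose odd and even terms
    contradict [trace_proximity], or finitely many [eta]-balls cover some trace. In the second case
    one [eta]-ball meets every trace, and then some trace avoids everything at distance at least
    [eps] from its centre. *)
Lemma trace_small (x : X) (eps : R) : 0 < eps -> exists2 r, 0 < r &
  exists c, forall y, trace x r y -> mdist c y < eps.
Proof.
move=> eps0; pose eta := eps / 2; have eta0 : 0 < eta by rewrite divr_gt0.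
have inv0 n : 0 < n.+1%:R^-1 :> R by rewrite invr_gt0 ltr0n.
have [sep|] := pselect (forall n (l : seq Y),
    exists2 y, trace x n.+1%:R^-1 y & forall z, z \in l -> eta <= mdist z y).
  have [y yt ysep] := sparse_choice sep.
  have meet b t : 0 < t -> trace x t `&` [set y k | k in [set k | odd k = b]] !=set0.
    move=> t0; have [k kb kt] := exists_invS_lt b t0; exists (y k); split.
      by apply: traceS (yt k); exact: ltW.
    by exists k.
  exfalso; apply: (@trace_proximity x _ _ (eta / 3) _ _ (meet true) (meet false)).
    by rewrite divr_gt0.
  move=> _ _ [i io <-] [j jo <-]; rewrite mulrC divfK//.
  have : i != j by apply: contra_eqN jo => /eqP <-; rewrite io.
  by rewrite neq_ltn => /orP[/ysep//|/ysep]; rewrite metric_sym.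
move=> /existsNP[n /existsNP[l hl]].
have cover y : trace x n.+1%:R^-1 y -> exists2 z, z \in l & mdist z y < eta.
  move=> ty; apply: contrapT => h; apply: hl; exists y => // z zl.
  by rewrite leNgt; apply/negP => zy; apply: h; exists z.
have [c hc] : exists c, forall t, 0 < t ->
    trace x t `&` [set y | mdist c y < eta] !=set0.
  apply: contrapT => /forallNP hc.
  (* If the ball around each centre in [l] missed some trace, the least of these finitely many radii
     would give a trace missing all of them. *)
  have [t t0 tP] : exists2 t, 0 < t &
    forall z y, z \in l -> trace x t y -> eta <= mdist z y.
    elim: l {hl cover} => [|a l [t t0 tP]]; first by exists 1.
    have /existsNP[t' /not_implyP[t'0 t'P]] := hc a.
    exists (Num.min t t'); first by rewrite lt_min t0.
    move=> z y; rewrite inE => /orP[/eqP ->|zl] ty.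
      rewrite leNgt; apply/negP => ay; apply: t'P; exists y; split=> //.
      by apply: traceS ty; rewrite ge_min lexx orbT.
    by apply: tP => //; apply: traceS ty; rewrite ge_min lexx.
  have [|y ty] := @trace_neq0 x (Num.min t n.+1%:R^-1).
    by rewrite lt_min t0 inv0.
  have [|z zl zy] := cover y; first by apply: traceS ty; rewrite ge_min lexx orbT.
  suff : eta <= mdist z y by rewrite leNgt zy.
  by apply: tP => //; apply: traceS ty; rewrite ge_min lexx.
apply: contrapT => hN.
apply: (@trace_proximity x [set y | mdist c y < eta]
  [set y | eps <= mdist c y] (eta / 3)).
- by rewrite divr_gt0.
- move=> u v /= cu cv; rewrite mulrC divfK//.
  by have := metric_triangle c u v; move: cu cv; rewrite /eta; lra.
- exact: hc.
- move=> t t0; apply: contrapT => h; apply: hN; exists t => //; exists c => y ty.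
  by rewrite ltNge; apply/negP => cy; apply: h; exists y.
Qed.

(** By [trace_small], points chosen in the traces of radius [1/(n+1)] form a Cauchy sequence. Its
    limit attracts whole traces, because a small trace contains all late terms. *)
Lemma trace_limit_exists : complete_metric Y -> exists h, trace_limit Sigma T h.
Proof.
move=> cY; suff /choice[h hP] : forall x, exists p, forall eps, 0 < eps ->
  exists2 r, 0 < r & forall y, trace x r y -> mdist p y < eps by exists h.
move=> x; have inv0 n : 0 < n.+1%:R^-1 :> R by rewrite invr_gt0 ltr0n.
have /choice[y yt] : forall n, exists y, trace x n.+1%:R^-1 y.
  by move=> n; have [y] := trace_neq0 x (inv0 n); exists y.
have y_near r : 0 < r -> \forall n \near \oo, trace x r (y n).
  move=> r0; have [k _ kr] := exists_invS_lt true r0; exists k => // n /= kn.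
  apply: traceS (yt n); apply: le_trans (ltW kr).
  by rewrite lef_pV2 ?posrE ?ltr0n// ler_nat.
have [p yp] : exists p : Y, y @ \oo --> p.
  apply: cY; apply: (@cauchy_exP _ _ (y @ \oo)) => eps eps0.
  have [r r0 [c rc]] := trace_small x eps0; exists c.
  have := y_near r r0; apply: filterS => n /rc.
  by rewrite ballEmdist.
exists p => eps eps0.
have eps3 : 0 < eps / 3 by rewrite divr_gt0.
have [r r0 [c rc]] := trace_small x eps3; exists r => // z /rc cz.
have : \forall n \near \oo, mdist p (y n) < eps / 3 /\ trace x r (y n).
  apply: filterI; last exact: y_near.
  exact: (metricType_numDomainType.cvgr_dist_lt yp).
move=> /filter_ex[n [pn /rc cn]].
have := metric_triangle p (y n) z; have := metric_triangle (y n) c z.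
by rewrite [mdist (y n) c]metric_sym; lra.
Qed.

End Biseparating.

(** * The point map is a homeomorphism, and [T f (h x)] depends only on [f x] *)

Section WeightedComposition.
Context {R : realType} {s : scalars} {X Y : metricType R}.
Context {E F : normedModType (scalar_field R s)}.
Context {Sigma Sigma' : set (R -> \bar R)}.
Context {T : (X -> E) -> (Y -> F)} {S : (Y -> F) -> (X -> E)}.
Hypothesis nX : normal_Lip Sigma X E.
Hypothesis nY : normal_Lip Sigma' Y F.
Hypothesis TS : inv_biseparating Sigma Sigma' T S.
Context {h : X -> Y} {k : Y -> X}.
Hypothesis hlim : trace_limit Sigma T h.
Hypothesis klim : trace_limit Sigma' S k.

Let hS := normal_Lip_modulus nX.
Let hS' := normal_Lip_modulus nY.

(** For a bump [u] at [x] with small support, [T u] is supported near [h x]. As [u = S (T u)] is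
    nonzero at [x], this puts [x] in a small trace of [S] at [h x]. *)
Lemma trace_limitK : cancel h k.
Proof.
move=> x; apply: mdist_positivity; apply/eqP/contraT => kx0.
have kx : 0 < mdist (k (h x)) x by rewrite lt_def kx0 mdist_ge0.
(* The tolerance is the supposed distance itself, so the conclusion reads that it is smaller than
   itself. *)
have [d d0 dP] := klim (h x) kx; have [r r0 rP] := hlim x d0.
suff /dP : trace Sigma' S (h x) d x by rewrite ltxx.
have [u [uL ux u0]] :=
  Lip_bump hS x (normal_Lip_normal nX) (normal_Lip_neq0 nX) r0.
exists (T u); split; [exact: (bisep_Lip TS)|move=> z hz|by rewrite (bisepK TS)].
apply/eqP/contraT => Tuz; suff /rP : trace Sigma T x r z by rewrite ltNge hz.
by exists u.
Qed.

(** For [z] near [x], small traces at [z] lie in a trace at [x], so a single point is close to both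
    [h x] and [h z]. *)
Lemma trace_limit_continuous : continuous h.
Proof.
move=> x; apply/metricType_numDomainType.cvgrPdist_lt => eps eps0.
have eps2 : 0 < eps / 2 by rewrite divr_gt0.
have [r r0 rP] := hlim x eps2.
apply/metricType_numDomainType.nbhs_mdistP; exists r => // z /= xz.
have [r' r'0 r'P] := hlim z eps2.
have [|y ty] := @trace_neq0 _ _ _ _ _ _ _ _ _ _ nX TS z (Num.min r' (r - mdist x z)).
  by rewrite lt_min r'0 subr_gt0.
have : mdist (h x) y < eps / 2.
  apply: rP; apply: trace_le ty; have := ge_min (r - mdist x z) r' (r - mdist x z).
  by rewrite lexx orbT; lra.
have : mdist (h z) y < eps / 2.
  by apply: r'P; apply: traceS ty; rewrite ge_min lexx.
by have := metric_triangle (h x) y (h z); rewrite [mdist y (h z)]metric_sym; lra.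
Qed.

(** A bump [w] at [h x] supported where [T f] is nonzero has [S w] supported near [x], where [f]
    vanishes; [bisep_support] then forces [S w] to vanish at a point where it does not. *)
Lemma bisep_local f x r : Lip Sigma X E f -> 0 < r ->
  (forall z, mdist x z < r -> f z = 0) -> T f (h x) = 0.
Proof.
move=> fL r0 f0; apply/eqP/contraT => Tfx.
have [d d0 dP] := klim (h x) r0; rewrite trace_limitK in dP.
have [d' d'0 d'P] := Lip_neq0_near hS' (bisep_Lip TS fL) Tfx.
have m0 : 0 < Num.min d d' by rewrite lt_min d0.
have [w [wL wy w0]] :=
  Lip_bump hS' (h x) (normal_Lip_normal nY) (normal_Lip_neq0 nY) m0.
have ST := inv_biseparating_sym hS TS.
have SwL := bisep_LipV TS wL.
have [z Swz] := bisep_neq0 nY ST wL wy.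
have xz : mdist x z < r.
  apply: dP; exists w; split=> // z' dz'; apply: w0.
  by rewrite ge_min dz'.
suff Swz0 : S w z = 0 by rewrite Swz0 eqxx in Swz.
apply: (@bisep_support _ _ _ _ _ _ _ _ _ _ nX TS f _ z (r - mdist x z)) => //.
- move=> y Tfy; rewrite (bisepKV TS)//; apply: w0.
  rewrite ge_min; apply/orP; right; rewrite leNgt.
  by apply/negP => /d'P; rewrite Tfy eqxx.
- by rewrite subr_gt0.
- by move=> z' zz'; apply: f0; have := metric_triangle x z z'; lra.
Qed.

Lemma bisep_local_eq f g x r : Lip Sigma X E f -> Lip Sigma X E g -> 0 < r ->
  (forall z, mdist x z < r -> f z = g z) -> T f (h x) = T g (h x).
Proof.
move=> fL gL r0 fg; apply/eqP; rewrite -subr_eq0.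
have := @bisep_local (f - g) x r (LipB hS fL gL) r0.
rewrite (bisepB TS)// => fg0; apply/eqP/fg0 => z /fg fgz.
by rewrite fctE/= fgz subrr.
Qed.

(** Unless [f] vanishes near [x], alternate it along points tending to [x] with rapidly decreasing
    nonzero values. Locality and continuity of [h] give [T g (h x) = 0] from the even terms and
    [T f (h x) = T g (h x)] from the odd ones. *)
Lemma bisep_vanish f x : Lip Sigma X E f -> f x = 0 -> T f (h x) = 0.
Proof.
move=> fL fx0.
have [[r r0 rP]|nloc] := pselect (exists2 r, 0 < r &
    forall z, mdist x z < r -> f z = 0).
  exact: bisep_local rP.
have near0 r : 0 < r -> exists2 z, mdist x z < r & f z != 0.
  move=> r0; apply: contrapT => hN; apply: nloc; exists r => // z zr.
  by apply/eqP/contraT => fz; exfalso; apply: hN; exists z.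
have [n l|y yP ysp] := @sparse_choice X
    (fun n => [set z | mdist x z < n.+1%:R^-1 /\ f z != 0])
    (* The premise is there because [sparse_choice] allows arbitrary lists, which may contain zeros
       of [f]. *)
    (fun z y => f z != 0 -> 4 * rnorm (f y) <= rnorm (f z)).
  have [M MP] := seq_le_ub (fun z => (rnorm (f z))^-1) l.
  (* The inverse of [M1] is a positive lower bound for the nonzero values of [|f|] on the list. *)
  pose M1 := Num.max M 1; have M10 : 0 < M1 by rewrite lt_max ltr01 orbT.
  have [|d d0 dP] := @Lip_near _ _ _ _ hS _ f x (M1^-1 / 4) fL.
    by rewrite divr_gt0 ?invr_gt0.
  have [|z] := near0 (Num.min d n.+1%:R^-1).
    by rewrite lt_min d0 invr_gt0 ltr0n.
  rewrite lt_min => /andP[/dP fz zn] fz0; exists z => // z' /MP z'M fz'0.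
  have : M1^-1 <= rnorm (f z').
    rewrite -[leRHS]invrK lef_pV2 ?posrE ?invr_gt0 ?rnorm_gt0//.
    by rewrite le_max z'M.
  by move: fz; rewrite fx0 sub0r rnormN; lra.
have [||g gL gP] := @Lip_alternate _ _ _ _ _ hS f y fL.
- by move=> n; have [] := yP n.
- move=> i j; have [_ fi] := yP i; have [_ fj] := yP j.
  by rewrite neq_ltn => /orP[/ysp/(_ fi)|/ysp/(_ fj)]; [right|left].
have [TfL TgL] := (bisep_Lip TS fL, bisep_Lip TS gL).
have near_h b d : 0 < d -> exists2 i, odd i = b & mdist (h x) (h (y i)) < d.
  move=> d0; have hc := @trace_limit_continuous x.
  have /metricType_numDomainType.cvgrPdist_lt/(_ _ d0) := hc.
  move=> /metricType_numDomainType.nbhs_mdistP[e /= e0 eP].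
  have [i ib ie] := exists_invS_lt b e0; exists i => //; apply: eP => /=.
  by apply: lt_trans ie; have [] := yP i.
have Tg0 : T g (h x) = 0.
  apply: (Lip_eq0 hS' TgL) => d /(near_h false)[i io hi]; exists (h (y i)) => //.
  have [r r0 rP] := gP i; apply: (bisep_local gL r0) => z /rP.
  by rewrite io.
apply/eqP; rewrite -[X in X == _]subr0 -{1}Tg0; apply/eqP.
apply: (@Lip_eq0 _ _ _ _ _ hS' (T f - T g)) => [|d /(near_h true)[i io hi]].
  exact: LipB.
exists (h (y i)) => //; have [r r0 rP] := gP i.
apply/eqP; rewrite subr_eq0; apply/eqP; apply: (bisep_local_eq fL gL r0) => z /rP.
by rewrite io.
Qed.

(** Apply [bisep_vanish] to [f - cst (f x)]. *)
Lemma bisep_evalE f x : Lip Sigma X E f -> T f (h x) = T (cst (f x)) (h x).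
Proof.
move=> fL; have cL : Lip Sigma X E (cst (f x)) := Lip_cst hS _.
apply/eqP; rewrite -subr_eq0.
have := @bisep_vanish (f - cst (f x)) x (LipB hS fL cL).
by rewrite (bisepB TS)// => fx0; apply/eqP/fx0; rewrite fctE/= subrr.
Qed.

End WeightedComposition.

(** * Assembly of the homeomorphism and the fibre isomorphisms *)

Theorem theorem16 (R : realType) (s : scalars) (X Y : metricType R)
  (E F : completeNormedModType (scalar_field R s))
  (Sigma Sigma' : set (R -> \bar R))
  (T : (X -> E) -> (Y -> F))
  (hX : complete_metric X) (hY : complete_metric Y)
  (hE : exists e : E, e != 0) (hF : exists v : F, v != 0)
  (hSigma : modulus_set Sigma) (hSigma' : modulus_set Sigma')
  (hnX : Lipschitz_normal s Sigma X) (hnY : Lipschitz_normal s Sigma' Y)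
  (hTlin : linear_on (Lip Sigma X E) T)
  (hT : biseparating (Lip Sigma X E) (Lip Sigma' Y F) T) :
  exists (h : X -> Y) (hinv : Y -> X) (S : Y -> {linear E -> F}),
    [/\ homeomorphism h hinv,
        forall y, bijective (S y) &
        forall f y, Lip Sigma X E f -> T f y = S y (f (hinv y))].
Proof.
have [[Tfun Tinj Tsurj] Tdisj] := hT.
have nX : normal_Lip Sigma X E by split.
have nY : normal_Lip Sigma' Y F by split.
(* [U] picks preimages under [T]; outside the Lipschitz space its value is arbitrary. *)
have /choice[U UP] : forall g, exists f, Lip Sigma' Y F g ->
    Lip Sigma X E f /\ T f = g.
  move=> g; have [/Tsurj[f fL Tf]|gL] := pselect (Lip Sigma' Y F g).
    by exists f.
  by exists 0.
have TU : inv_biseparating Sigma Sigma' T U.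
  split=> // [g /UP[]//|f fL|g /UP[]//].
  have [UL UK] := UP (T f) (Tfun f fL).
  by apply: Tinj; rewrite ?inE.
have UT := inv_biseparating_sym hSigma TU.
have [h hlim] := trace_limit_exists nX nY TU hY.
have [k klim] := trace_limit_exists nY nX UT hX.
have hK := trace_limitK nX TU hlim klim.
have kK := trace_limitK nY UT klim hlim.
pose W y (e : E) := T (cst e) y.
have cstL (e : E) : Lip Sigma X E (cst e) := Lip_cst hSigma e.
have Wlin y : linear (W y).
  by move=> a u v; rewrite /W -[cst _]/(a *: cst u + cst v) hTlin.
have TE f y : Lip Sigma X E f -> T f y = W y (f (k y)).
  by move=> fL; rewrite -{1}(kK y) (bisep_evalE nX nY TU hlim klim)// kK.
pose SS y : {linear E -> F} := HB.pack (W y)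
  (GRing.isLinear.Build _ _ _ _ (W y) (Wlin y)).
exists h, k, SS; split.
- split=> //; first exact: (trace_limit_continuous nX TU hlim).
  exact: (trace_limit_continuous nY UT klim).
(* The inverse on the fibre is the same construction for [U]. One composition uses the evaluation
   formula for [U] at [T (cst e)], the other uses [TE] at [U (cst v)]. *)
- move=> y; exists (fun v => U (cst v) (k y)) => [e|v] /=.
    rewrite /W -(bisep_evalE nY nX UT klim hlim); last exact: Tfun.
    by rewrite (bisepK TU).
  have vL : Lip Sigma' Y F (cst v) := Lip_cst hSigma' v.
  have [UL UK] := UP _ vL.
  by rewrite -[LHS]/(W y (U (cst v) (k y))) -TE// UK.
- by move=> f y fL; rewrite TE.
Qed.
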